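(* Let $r\in\mathbb{N}$ with $r\ge 3$, let $\beta=(\beta_n)$ be a nonnegative sequence, and let $a=(a_n)\in RBVS(\beta,r)$. If $$\sum_{k=1}^{\infty}\frac{\beta_k}{k}<\infty,$$ then $\|S_n(f)-f\|=o(1)$ as $n\to\infty$.
   Context: $\mathbb{N}=\{1,2,\dots\}$. For a nonnegative sequence $\beta=(\beta_n)$ and $r\in\mathbb{N}$, a sequence of complex numbers $(a_n)$ belongs to $RBVS(\beta,r)$ (is a $(\beta,r)$-rest bounded variation sequence) if there is a constant $C$ such that $\sum_{n=m}^{\infty}|a_n-a_{n+r}|\le C\beta_m$ for all $m\in\mathbb{N}$. The norm is $\|F\|=\frac1{2\pi}\int_{-\pi}^{\pi}|F(x)|\,dx$. For the cosine series $\frac{a_0}{2}+\sum_{k=1}^{\infty}a_k\cos kx$ ($a_0\in\mathbb{C}$), $S_n(f,x)=\frac{a_0}{2}+\sum_{k=1}^{n}a_k\cos kx$ denotes its partial sums and $f(x)$ its sum at each point $x$ where the series converges; the conclusion includes that $f$ is defined almost everywhere.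
   Formalization: The formal theorem adds the hypothesis that a_n tends to 0; without it the claim fails (a_n = 1, β_n = 0 gives a series converging nowhere), and a.e. convergence of the cosine series forces a_n → 0 anyway. *)

(* Defs.v *)
From HB Require Import structures.
From mathcomp Require Import all_boot all_order all_algebra.
From mathcomp Require Import all_classical all_reals all_analysis.
From mathcomp Require Export complex.

Set Implicit Arguments.
Unset Strict Implicit.
Unset Printing Implicit Defensive.

Import Order.TTheory GRing.Theory Num.Theory.
Import numFieldNormedType.Exports.

Local Open Scope classical_set_scope.
Local Open Scope ring_scope.
Local Open Scope complex_scope.

(* Sequences are functions on [nat] but are indexed mathematically by
   n = 1, 2, ...: every condition below only involves indices >= 1.  The entry
   [a 0] of a coefficient sequence serves as the constant coefficient a_0 of
   the cosine series; the entry [beta 0] is never used.  *)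

Definition RBVS (R : realType) (beta : nat -> R) (r : nat) (a : nat -> R[i]) :
    Prop :=
  exists C : R, forall m : nat, (1 <= m)%N ->
    (\sum_(m <= n <oo) (Normc.normc (a n - a (n + r)%N))%:E
       <= (C * beta m)%:E)%E.

Definition cos_psum (R : realType) (a : nat -> R[i]) (n : nat) (x : R) : R[i] :=
  a 0%N / 2%:R + \sum_(1 <= k < n.+1) a k * (cos (k%:R * x))%:C.

(* The topology on [R[i]] is the one of its regular module [R[i]^o], given by
   the complex modulus.  At a point where the series diverges [lim] returns an
   unspecified value. *)
Definition cos_cvg_at (R : realType) (a : nat -> R[i]) (x : R) : Prop :=
  cvg ((fun n => cos_psum a n x : R[i]^o) @ \oo).

Definition cos_sum (R : realType) (a : nat -> R[i]) (x : R) : R[i] :=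
  lim ((fun n => cos_psum a n x : R[i]^o) @ \oo).

Definition L1norm (R : realType) (F : R -> R[i]) : \bar R :=
  (((2 * pi)^-1)%R%:E *
    \int[lebesgue_measure]_(x in `[(- pi)%R, pi%R]) (Normc.normc (F x))%:E)%E.

(* Main.v *)
Require Import Defs.
From mathcomp Require Import all_boot all_order all_algebra.
From mathcomp Require Import all_classical all_reals all_analysis.
From mathcomp Require Import measurable_realfun zify ring lra.

(** Convergence in mean of the cosine series follows from Abel summation with
    step [r].  Put [delta k = |a k - a (k + r)|].  Summing by parts along each
    residue class modulo [r] replaces the coefficients by their step
    differences, and [cos (k x)] by the kernel
      [D (b + i) = sum of the cos (l x), b <= l <= b + i, l = b + i mod r],
    where [b = n + 1] for the remainder of [S_n].
    The factor [2 sin (r x / 2)] telescopes this kernel, so that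
    [|D (b + i)| <= min (i + 1, 1 / |sin (r x / 2)|)]
    ([norm_step_kernel_le], [step_kernel_sin_le]).  Since [a] tends to [0], the
    boundary terms vanish wherever [sin (r x / 2) <> 0], that is off a countable
    set; there the series converges ([cos_psum_cvg]) and
      [|S_n x - f x| <= sum over k > n of
         delta k * min (k, 1 / |sin (r x / 2)|)]
    ([cos_psum_sum_le]).

    The integral of [min (k, 1 / |sin (r x / 2)|)] over a period is of the order
    of the harmonic number [H_k].  This is obtained by counting instead of
    integrating [1 / |sin|]: a real number [d] between [0] and [k] is at most
    the number of [j < k] with [j <= d], so the minimum is at most the number of
    [j < k] with [j |sin (r x / 2)| <= 1], and for each [j] these [x] lie in
    [2 r + 1] intervals of length [O (1 / (j + 1))] around the zeros of the sine
    ([le_kernel_majorant], [integral_kernel_majorant_le]).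

    Hence [||S_n - f||] is at most a constant times the tail
    [sum over k > n of delta k * H_k] ([L1norm_remainder_le]).  Exchanging the
    order of summation,
      [sum_k delta k * H_k = sum_j (1 / j) * sum over k >= j of delta k
                          <= C * sum_j beta j / j],
    which is finite ([RBVS_weighted_summable]), so the tail tends to [0]. *)

Set Implicit Arguments.
Unset Strict Implicit.
Unset Printing Implicit Defensive.

Import Order.TTheory GRing.Theory Num.Theory.
Import numFieldNormedType.Exports HBNNSimple.

Local Open Scope classical_set_scope.
Local Open Scope ring_scope.
Local Open Scope complex_scope.

(** * The sine near its zeros *)

(** Halving the angle keeps both cosines in play at least [cos (pi / 4)]:
    [sin t = 2 cos h sin h] with [h = t / 2], and [sin h = h cos c] with
    [0 < c < h] by the mean value theorem, while [2 (cos h)^2 >= 1]. *)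
Lemma half_norm_le_norm_sin (R : realType) (t : R) :
  `|t| <= pi / 2 -> `|t| / 2 <= `|sin t|.
Proof.
wlog t0 : t / 0 < t => [H|].
  case: (ltrgtP t 0) => [tn|tp|->]; last 2 first.
  - exact: H.
  - by rewrite sin0 normr0 mul0r.
  by rewrite -[`|t|]normrN -[`|sin t|]normrN -sinN; apply: H; rewrite oppr_gt0.
rewrite (gtr0_norm t0) => tpi.
pose h := t / 2.
have h0 : 0 < h by rewrite /h divr_gt0.
have pi0 := pi_gt0 R.
have [c] := @MVT R sin cos 0 h h0 (fun x _ => is_derive_sin x)
  (continuous_subspaceT (@continuous_sin R)).
rewrite in_itv /= sin0 !subr0 => /andP[c0 ch] sinh.
have hpi : h < pi / 2 by rewrite /h; lra.
have coshc : cos h <= cos c.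
  by apply: ltW; rewrite ltr_cos ?in_itv /=; lra.
have cosh0 : 0 < cos h by apply: cos_gt0_pihalf; apply/andP; split; lra.
have cosh2 : 1 <= cos h ^+ 2 *+ 2.
  rewrite -subr_ge0 -cos_mulr2n; apply: cos_ge0_pihalf.
  rewrite -mulr_natr /h; apply/andP; split; lra.
have -> : t = h *+ 2 by rewrite -mulr_natr /h; lra.
rewrite sin_mulr2n sinh; apply: le_trans (ler_norm _).
have : cos h * cos h <= cos h * cos c by rewrite ler_pM2l.
move: cosh2; rewrite expr2 -mulr_natr => cosh2 cosch.
have : 2^-1 <= cos h * cos c by lra.
rewrite mulrA => /(ler_wpM2r (ltW h0)); lra.
Qed.

Lemma near_pi_multiple (R : realType) (y : R) :
  exists l : int, `|y - l%:~R * pi| <= pi / 2 /\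
                  `|y - l%:~R * pi| <= 2 * `|sin y|.
Proof.
have pi0 := pi_gt0 R.
pose l := Num.floor (y / pi + 2^-1); exists l.
have tpi : `|y - l%:~R * pi| <= pi / 2.
  have /andP[] := floor_itv (y / pi + 2^-1); rewrite -/l intrD => l1 l2.
  have yE : y = y / pi * pi by rewrite divfK // gt_eqF.
  have : (l%:~R - 2^-1) * pi <= y by rewrite [leRHS]yE ler_pM2r //; lra.
  have : y <= (l%:~R + 2^-1) * pi.
    by rewrite [leLHS]yE ler_pM2r //; move: l2; rewrite /=; lra.
  by move=> ? ?; rewrite ler_norml; apply/andP; split; lra.
split=> //; have := half_norm_le_norm_sin tpi.
suff -> : `|sin (y - l%:~R * pi)| = `|sin y| by lra.
case: l {tpi} => n.
  rewrite -[in RHS](subrK (n%:Z%:~R * pi) y) /= mulr_natl.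
  by rewrite (alternatingn (@sinDpi R)) normrM normrX normrN1 expr1n mul1r.
rewrite NegzE mulrNz mulNr opprK mulr_natl.
by rewrite (alternatingn (@sinDpi R)) normrM normrX normrN1 expr1n mul1r.
Qed.

(** * The cosine kernel of a residue class *)

(** The indices run through the class of [b + i] modulo [r], from [b] up to
    [b + i]; counting them from the bottom makes [i |-> i + r] append one term,
    which is the recurrence that summation by parts needs. *)
Definition step_kernel (R : realType) (r b : nat) (x : R) (i : nat) : R :=
  \sum_(l < (i %/ r).+1) cos ((b + i %% r + l * r)%:R * x).

Lemma step_kernel_small (R : realType) (r b : nat) (x : R) (i : nat) :
  (i < r)%N -> step_kernel r b x i = cos ((b + i)%:R * x).
Proof.
move=> ir; rewrite /step_kernel divn_small // modn_small //.
by rewrite big_ord_recr big_ord0 /= mul0n addn0 add0r.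
Qed.

Lemma step_kernelD (R : realType) (r b : nat) (x : R) (i : nat) : (0 < r)%N ->
  step_kernel r b x (i + r) = step_kernel r b x i + cos ((b + i + r)%:R * x).
Proof.
move=> r0; rewrite /step_kernel modnDr divnDr // divnn r0 addn1 big_ord_recr /=.
congr (_ + cos (_%:R * x)).
by rewrite mulSn [(r + _)%N]addnC addnA -(addnA b) (addnC (i %% r)%N) -divn_eq.
Qed.

Lemma norm_step_kernel_le (R : realType) (r b : nat) (x : R) (i : nat) :
  `|step_kernel r b x i| <= i.+1%:R.
Proof.
apply: (le_trans (ler_norm_sum _ _ _)).
apply: (@le_trans _ _ (\sum_(l < (i %/ r).+1) 1)).
  by apply: ler_sum => l _; rewrite cos_max.
by rewrite sumr_const card_ord ler_nat ltnS leq_div.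
Qed.

(** [2 sin (r x / 2) cos y = sin (y + r x / 2) - sin (y - r x / 2)], so the sum
    telescopes and only two sines remain. *)
Lemma step_kernel_sin_le (R : realType) (r b : nat) (x : R) (i : nat) :
  `|step_kernel r b x i| * `|sin (r%:R * x / 2)| <= 1.
Proof.
rewrite /step_kernel; set c := (b + i %% r)%N; set s := sin _.
have H q : 2 * s * \sum_(l < q) cos ((c + l * r)%:R * x) =
    sin ((c + q * r)%:R * x - r%:R * x / 2) - sin (c%:R * x - r%:R * x / 2).
  elim: q => [|q IH]; first by rewrite big_ord0 mulr0 mul0n addn0 subrr.
  rewrite big_ord_recr /= mulrDr IH.
  have -> : (c + q.+1 * r)%:R * x - r%:R * x / 2 =
      (c + q * r)%:R * x + r%:R * x / 2.
    by rewrite mulSn !natrD; field.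
  by rewrite sinB [sin (_ + _ * _ / 2)]sinD -/s; ring.
rewrite -normrM -(ler_pM2l (ltr0n _ 2)) -[X in X * _](@ger0_norm _ 2%:R) // -normrM.
rewrite mulrCA mulrC H mulr1.
apply: (le_trans (ler_normB _ _)).
by apply: (@le_trans _ _ (1 + 1)); [apply: lerD; exact: sin_max | lra].
Qed.

(** * An integrable majorant of the kernel *)

(** The zeros of [sin (r x / 2)] on [[-pi, pi]] and a few more; the shift by [r]
    makes the index a natural number. *)
Definition pole (R : realType) (r m : nat) : R :=
  2 * pi * (m%:R - r%:R) / r%:R.

(** The half-width has [j + 1] in place of [j], so that the windows of index [0]
    have finite length and still cover [[-pi, pi]]. *)
Definition window (R : realType) (r j m : nat) : set R :=
  `[pole R r m - 8 / (r%:R * j.+1%:R), pole R r m + 8 / (r%:R * j.+1%:R)].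

(** The total length of the windows of index [j] is this number divided by
    [j + 1]. *)
Definition windows_mass (R : realType) (r : nat) : R :=
  (2 * r).+1%:R * (16 / r%:R).

Definition kernel_majorant (R : realType) (r k : nat) (x : R) : R :=
  \sum_(j < k) \sum_(m < (2 * r).+1) \1_(@window R r j m) x.

(** The multiple [l pi] nearest to [y = r x / 2] satisfies both
    [|y - l pi| <= pi / 2 <= 2] and [j |y - l pi| <= 2 j |sin y| <= 2]; adding
    the two gives [(j + 1) |y - l pi| <= 4]. *)
Lemma window_cover (R : realType) (r j : nat) (x : R) : (0 < r)%N ->
  `|x| <= pi -> j%:R * `|sin (r%:R * x / 2)| <= 1 ->
  (1 : R) <= \sum_(m < (2 * r).+1) \1_(@window R r j m) x.
Proof.
move=> r0 xpi js; have pi0 := pi_gt0 R.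
have r0' : (0 : R) < r%:R by rewrite ltr0n.
have r1 : (1 : R) <= r%:R by rewrite ler1n.
have [l [l1 l2]] := near_pi_multiple (r%:R * x / 2).
have lr : `|l%:~R| <= (r%:R : R).
  rewrite -(ler_pM2r pi0) -[X in _ * X <= _](gtr0_norm pi0) -normrM.
  rewrite -[l%:~R * pi](subrK (r%:R * x / 2)).
  apply: (le_trans (ler_normD _ _)); rewrite distrC.
  have -> : `|r%:R * x / 2| = r%:R * `|x| / 2.
    by rewrite !normrM (gtr0_norm r0') normfV (@ger0_norm _ 2).
  have : r%:R * `|x| <= r%:R * pi by rewrite ler_pM2l.
  have : (pi : R) <= r%:R * pi by rewrite ler_peMl // ltW.
  by move: l1; lra.
pose m := absz (l + r%:Z)%R.
have mE : (m%:R : R) = l%:~R + r%:R.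
  rewrite -[r%:R]/(r%:Z%:~R) -intrD /m natr_absz ger0_norm //.
  move: lr; rewrite ler_norml => /andP[]; rewrite -[r%:R]/(r%:Z%:~R) -intrN ler_int.
  by rewrite -subr_ge0 opprK.
have mr : (m < (2 * r).+1)%N.
  rewrite ltnS -(ler_nat R) mE natrM; move: lr; rewrite ler_norml => /andP[].
  by lra.
rewrite (bigD1 (Ordinal mr)) //= -[leLHS]addr0; apply: lerD; last first.
  by apply: sumr_ge0 => i _; rewrite indicE ler0n.
rewrite indicE mem_set //=.
have j0 : (0 : R) < j.+1%:R by rewrite ltr0n.
have H : `|x - pole R r m| <= 8 / (r%:R * j.+1%:R).
  have -> : x - pole R r m = 2 / r%:R * (r%:R * x / 2 - l%:~R * pi).
    by rewrite /pole mE; field; rewrite gt_eqF.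
  rewrite normrM gtr0_norm ?divr_gt0 //.
  have -> : 8 / (r%:R * j.+1%:R) = 2 / r%:R * (4 / j.+1%:R) :> R.
    by field; rewrite !gt_eqF // addr_gt0.
  rewrite ler_pM2l ?divr_gt0 // ler_pdivlMr // -[j.+1%:R]natr1 mulrDr mulr1.
  have := pihalf_lt2 R; move: l1.
  have : `|r%:R * x / 2 - l%:~R * pi| * j%:R <= 2 * `|sin (r%:R * x / 2)| * j%:R.
    by rewrite ler_wpM2r.
  by move: js; set u := `| _ - _ |; set s := `| _ |; lra.
by move: H; rewrite /window /= in_itv /= ler_distl.
Qed.

(** Each integer [j <= d] satisfies [j |sin (r x / 2)| <= 1] and so contributes
    at least [1] to the majorant; there are at least [d] of them below [k]. *)
Lemma le_kernel_majorant (R : realType) (r k : nat) (x d : R) : (0 < r)%N ->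
  `|x| <= pi -> 0 <= d -> d <= k%:R -> d * `|sin (r%:R * x / 2)| <= 1 ->
  d <= kernel_majorant r k x.
Proof.
move=> r0 xpi d0 dk ds; rewrite /kernel_majorant.
elim: k dk => [|k IH] dk; first by rewrite big_ord0.
have [dk'|kd] := lerP d k%:R.
  rewrite big_ord_recr /=; apply: ler_wpDr; last exact: IH.
  by apply: sumr_ge0 => i _; rewrite indicE ler0n.
apply: (le_trans dk).
have -> : k.+1%:R = \sum_(j < k.+1) (1 : R) by rewrite sumr_const card_ord.
apply: ler_sum => j _.
apply: window_cover => //; apply: le_trans ds; apply: ler_wpM2r => //.
by apply/ltW/(le_lt_trans _ kd); rewrite ler_nat -ltnS.
Qed.

Lemma kernel_majorant_ge0 (R : realType) (r k : nat) (x : R) :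
  0 <= kernel_majorant r k x.
Proof.
by apply: sumr_ge0 => j _; apply: sumr_ge0 => m _; rewrite indicE ler0n.
Qed.

Lemma measurable_kernel_majorant (R : realType) (r k : nat) (D : set R) :
  measurable_fun D (@kernel_majorant R r k).
Proof.
apply: measurable_sum => j; apply: measurable_sum => m.
by apply: measurable_indic; exact: measurable_itv.
Qed.

Lemma integral_kernel_majorant_le (R : realType) (r k : nat) (D : set R) :
  (0 < r)%N -> measurable D ->
  (\int[lebesgue_measure]_(x in D) (kernel_majorant r k x)%:E <=
   (\sum_(j < k) windows_mass R r / j.+1%:R)%:E)%E.
Proof.
move=> r0 mD; have r0' : (0 : R) < r%:R by rewrite ltr0n.
rewrite /kernel_majorant.
under eq_integral do rewrite -sumEFin.
rewrite ge0_integral_sum //; last first.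
- by move=> j x _; rewrite lee_fin; apply: sumr_ge0 => m _; rewrite indicE ler0n.
- move=> j; apply/measurable_EFinP; apply: measurable_sum => m.
  by apply: measurable_indic; exact: measurable_itv.
rewrite -sumEFin; apply: lee_sum => j _.
under eq_integral do rewrite -sumEFin.
rewrite ge0_integral_sum //; last first.
- move=> m; apply/measurable_EFinP.
  by apply: measurable_indic; exact: measurable_itv.
have -> : (windows_mass R r / j.+1%:R)%:E =
    (\sum_(m < (2 * r).+1) (16 / r%:R / j.+1%:R)%:E :> \bar R)%E.
  rewrite sumEFin sumr_const card_ord; congr EFin.
  by rewrite /windows_mass -[RHS]mulr_natl !mulrA.
apply: lee_sum => m _; rewrite integral_indic //; last exact: measurable_itv.
apply: (@le_trans _ _ (lebesgue_measure (@window R r j m))).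
  by apply: le_measure; rewrite ?inE //; [apply: measurableI => //| ];
    exact: measurable_itv.
have j0 : (0 : R) < j.+1%:R by rewrite ltr0n.
have e0 : 0 < 8 / (r%:R * j.+1%:R) :> R by rewrite divr_gt0 // mulr_gt0.
rewrite /window; set e := 8 / _ in e0 *; set p := pole R r m.
rewrite lebesgue_measure_itv /= lte_fin ifT; last by lra.
rewrite -EFinB lee_fin le_eqVlt; apply/orP; left; apply/eqP.
by rewrite /e; field; rewrite !gt_eqF // addr_gt0.
Qed.

(** * Complex sequences and the real-valued modulus *)

Section ComplexModulus.
Variable R : realType.
Implicit Types (x y : R[i]) (z : nat -> R[i]).
Local Notation normc := (@Normc.normc R).
Local Notation Re := (@complex.Re R).
Local Notation Im := (@complex.Im R).

Lemma normc_ge0 x : 0 <= normc x.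
Proof. by case: x => u v; exact: sqrtr_ge0. Qed.

Lemma ler_normcD x y : normc (x + y) <= normc x + normc y.
Proof. exact: le_normcD. Qed.

Lemma ler_normc_sum (n : nat) (F : nat -> R[i]) :
  normc (\sum_(i < n) F i) <= \sum_(i < n) normc (F i).
Proof.
elim: n => [|n IH]; first by rewrite !big_ord0 Normc.normc0.
rewrite !big_ord_recr /=; apply: (le_trans (ler_normcD _ _)).
by rewrite lerD2r.
Qed.

Lemma normcB x y : normc (x - y) = normc (y - x).
Proof. by rewrite -[LHS]normcN opprB. Qed.

Lemma normcMr x (u : R) : normc (x * u%:C) = normc x * `|u|.
Proof. by rewrite Normc.normcM /= expr0n addr0 sqrtr_sqr. Qed.

Lemma norm_Re_le x : `|Re x| <= normc x.
Proof.
case: x => u v /=; rewrite -sqrtr_sqr; apply: ler_wsqrtr.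
by rewrite lerDl sqr_ge0.
Qed.

Lemma norm_Im_le x : `|Im x| <= normc x.
Proof.
case: x => u v /=; rewrite -sqrtr_sqr; apply: ler_wsqrtr.
by rewrite lerDr sqr_ge0.
Qed.

Lemma normc_le_ReIm x : normc x <= `|Re x| + `|Im x|.
Proof.
case: x => u v /=; rewrite -[leRHS]ger0_norm ?addr_ge0 // -sqrtr_sqr.
apply: ler_wsqrtr; rewrite sqrrD !real_normK ?num_real // -addrA addrCA.
by rewrite [leRHS]addrC lerDl mulrn_wge0 // mulr_ge0.
Qed.

(** A positive element of [R[i]] is a positive real number, so the radii of the
    balls of [R[i]^o] may be taken in [R]. *)
Lemma complex_cvgP z x : ((z : nat -> R[i]^o) @ \oo --> (x : R[i]^o)) <->
  forall e : R, 0 < e -> exists N, forall n, (N <= n)%N -> normc (z n - x) <= e.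
Proof.
split=> [/cvgrPdist_le H e e0|H].
  have : (0 : R[i]) < e%:C by rewrite ltcR.
  move=> /H [N _ HN]; exists N => n Nn.
  by have := HN n Nn; rewrite /= -normcB -lecR.
apply/cvgrPdist_le => e; rewrite ltcE => /andP[/eqP e1 e2].
have [N HN] := H _ e2; exists N => // n /= Nn.
have -> : e = (Re e)%:C by case: e e1 {e2 HN} => u v /= ->.
by have := HN n Nn; rewrite /= normcB -lecR.
Qed.

Lemma real_cauchy_cvg (u : nat -> R) :
  (forall e, 0 < e -> exists p q, forall n, (q <= n)%N -> `|u n - u p| <= e) ->
  cvg (u @ \oo).
Proof.
move=> H; apply: cauchy_cvg; apply: cauchy_exP => e e0.
have e20 : 0 < e / 2 by rewrite divr_gt0.
have [p [q Hq]] := H _ e20; exists (u p); exists q => // n qn.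
rewrite /ball /= distrC; apply: (le_lt_trans (Hq n qn)).
by rewrite ltr_pdivrMr // ltr_pMr // ltr1n.
Qed.

Lemma complex_cauchy_cvg z :
  (forall e, 0 < e -> exists p q, forall n, (q <= n)%N -> normc (z n - z p) <= e) ->
  cvg ((z : nat -> R[i]^o) @ \oo).
Proof.
move=> H.
have [cR cI] : cvg ((fun n => Re (z n)) @ \oo) /\ cvg ((fun n => Im (z n)) @ \oo).
  split; apply: real_cauchy_cvg => e /H[p [q Hq]]; exists p, q => n /Hq; apply: le_trans.
    rewrite (_ : _ - _ = Re (z n - z p)) ?norm_Re_le //.
    by case: (z n) (z p) => ? ? [].
  rewrite (_ : _ - _ = Im (z n - z p)) ?norm_Im_le //.
  by case: (z n) (z p) => ? ? [].
set u := lim ((fun n => Re (z n)) @ \oo) in cR; pose v := lim ((fun n => Im (z n)) @ \oo).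
apply/cvg_ex; exists (u +i* v); apply/complex_cvgP => e e0.
have e20 : 0 < e / 2 by rewrite divr_gt0.
have [N1 _ H1] := cvgr_dist_le _ _ cR _ e20.
have [N2 _ H2] := cvgr_dist_le _ _ cI _ e20.
exists (maxn N1 N2) => n; rewrite geq_max => /andP[/H1 /= h1 /H2 /= h2].
apply: (le_trans (normc_le_ReIm _)); rewrite [leRHS]splitr; apply: lerD.
  by move: h1; rewrite distrC; case: (z n).
by move: h2; rewrite distrC; case: (z n).
Qed.

End ComplexModulus.

Lemma sum_shift (V : nmodType) (n M : nat) (F : nat -> V) :
  \sum_(n <= k < n + M) F k = \sum_(i < M) F (n + i)%N.
Proof.
rewrite -{1}[n]add0n big_addn addKn big_mkord.
by apply: eq_bigr => i _; rewrite addnC.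
Qed.

(** * Summation by parts with step r and pointwise convergence *)

(** Writing [c i = D i - D (i - r)], each [D i] is met twice, with the
    coefficients [f i] and [- f (i + r)], except for the last [r] of them. *)
Lemma abel_step_summation (R : comPzRingType) (r M : nat) (f c D : nat -> R) :
  (forall i, (i < r)%N -> D i = c i) ->
  (forall i, D (i + r)%N = D i + c (i + r)%N) ->
  \sum_(i < M + r) f i * c i =
  \sum_(i < M) (f i - f (i + r)%N) * D i + \sum_(i < r) f (M + i)%N * D (M + i)%N.
Proof.
move=> D0 DS; elim: M => [|M IH].
  by rewrite big_ord0 add0r; apply: eq_bigr => i _; rewrite -D0.
rewrite addSn !big_ord_recr /= {}IH.
have H : \sum_(i < r) f (M + i)%N * D (M + i)%N + f (M + r)%N * D (M + r)%N =
    f M * D M + \sum_(i < r) f (M.+1 + i)%N * D (M.+1 + i)%N.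
  transitivity (\sum_(i < r.+1) f (M + i)%N * D (M + i)%N).
    by rewrite big_ord_recr.
  rewrite big_ord_recl /= addn0; congr (_ + _); apply: eq_bigr => i _.
  by rewrite /bump /= add1n addSnnS.
have -> : \sum_(i < r) f (M.+1 + i)%N * D (M.+1 + i)%N =
  \sum_(i < r) f (M + i)%N * D (M + i)%N + f (M + r)%N * D (M + r)%N - f M * D M.
  by rewrite H addrC addKr.
by rewrite DS; ring.
Qed.

Section CosineSeries.
Variables (R : realType) (r : nat) (a : nat -> R[i]).
Hypothesis r0 : (0 < r)%N.
Local Notation normc := (@Normc.normc R).

Definition step_diff (k : nat) : R := normc (a k - a (k + r)%N).

Lemma step_diff_ge0 k : 0 <= step_diff k.
Proof. exact: normc_ge0. Qed.

Lemma cos_psumB (n N : nat) (x : R) :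
  cos_psum a (n + N) x - cos_psum a n x =
  \sum_(i < N) a (n.+1 + i)%N * (cos ((n.+1 + i)%:R * x))%:C.
Proof.
rewrite /cos_psum addrAC opprD addNKr -addSn.
rewrite [X in _ + X](@big_cat_nat _ _ _ n.+1) //=; last by lia.
by rewrite addKr sum_shift.
Qed.

Lemma cos_psumB_le (n M : nat) (x : R) :
  normc (cos_psum a (n + (M + r)) x - cos_psum a n x) <=
  \sum_(i < M) step_diff (n.+1 + i) * `|step_kernel r n.+1 x i| +
  \sum_(i < r) normc (a (n.+1 + (M + i))%N) * `|step_kernel r n.+1 x (M + i)|.
Proof.
rewrite cos_psumB.
rewrite (@abel_step_summation _ r M (fun i => a (n.+1 + i)%N)
  (fun i => (cos ((n.+1 + i)%:R * x))%:C)
  (fun i => (step_kernel r n.+1 x i)%:C)); first last.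
- by move=> i; rewrite step_kernelD // rmorphD /= addnA.
- by move=> i ir; rewrite step_kernel_small.
apply: (le_trans (ler_normcD _ _)); apply: lerD.
  apply: (le_trans (ler_normc_sum _
    (fun i => (a (n.+1 + i)%N - a (n.+1 + (i + r))%N) * (step_kernel r n.+1 x i)%:C))).
  by apply: ler_sum => i _; rewrite normcMr /step_diff addnA.
apply: (le_trans (ler_normc_sum _
    (fun i => a (n.+1 + (M + i))%N * (step_kernel r n.+1 x (M + i))%:C))).
by apply: ler_sum => i _; rewrite normcMr.
Qed.

Lemma step_kernel_le_inv_sin (b i : nat) (x : R) : sin (r%:R * x / 2) != 0 ->
  `|step_kernel r b x i| <= `|sin (r%:R * x / 2)|^-1.
Proof.
by move=> s0; rewrite -[leRHS]mul1r ler_pdivlMr ?normr_gt0 // step_kernel_sin_le.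
Qed.

Hypothesis a_cvg0 : (fun n => a n : R[i]^o) @ \oo --> (0 : R[i]^o).

(** These are the [r] boundary terms of the summation by parts: the kernel stays
    bounded at a fixed [x] while the coefficients tend to [0]. *)
Lemma boundary_small (n : nat) (x e : R) : sin (r%:R * x / 2) != 0 -> 0 < e ->
  exists N, forall M, (N <= M)%N ->
  \sum_(i < r) normc (a (n.+1 + (M + i))%N) * `|step_kernel r n.+1 x (M + i)| <= e.
Proof.
move=> s0 e0; have s0' : 0 < `|sin (r%:R * x / 2)| by rewrite normr_gt0.
have r0' : (0 : R) < r%:R by rewrite ltr0n.
have e1 : 0 < e * `|sin (r%:R * x / 2)| / r%:R by rewrite divr_gt0 // mulr_gt0.
have [N HN] := (complex_cvgP a 0).1 a_cvg0 _ e1.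
exists N => M NM; apply: (@le_trans _ _ (\sum_(i < r) e / r%:R)); last first.
  by rewrite sumr_const card_ord -[leLHS]mulr_natr divfK // gt_eqF.
apply: ler_sum => i _.
have Nk : (N <= n.+1 + (M + i))%N by rewrite addnCA (leq_trans NM) // leq_addr.
have := HN _ Nk; rewrite subr0 => h.
apply: (le_trans (ler_pM (normc_ge0 _) (normr_ge0 _) h (step_kernel_le_inv_sin _ _ s0))).
by rewrite le_eqVlt; apply/orP; left; apply/eqP; field; rewrite !gt_eqF.
Qed.

Hypothesis step_diff_summable : (\sum_(1 <= k <oo) (step_diff k)%:E < +oo)%E.

Lemma step_diff_tail_small (e : R) : 0 < e ->
  exists n, forall M, \sum_(i < M) step_diff (n.+1 + i) <= e.
Proof.
move=> e0; pose g i := (step_diff i.+1)%:E.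
have g0 i : (0 <= g i)%E by rewrite lee_fin step_diff_ge0.
have gfin : (\sum_(0 <= i <oo) g i < +oo)%E.
  rewrite (_ : \sum_(0 <= i <oo) g i = \sum_(1 <= k <oo) (step_diff k)%:E)%E //.
  rewrite -(nneseries_addn (f := fun k => (step_diff k)%:E) 1).
    by apply: eq_eseriesr => i _; rewrite addn1.
  by move=> i; rewrite lee_fin step_diff_ge0.
have /fine_cvgP[fin tail] := nneseries_tail_cvg gfin (fun i _ => g0 i).
have [N1 _ H1] := fin.
have [N2 _ H2] := cvgr_dist_le _ _ tail _ e0.
exists (maxn N1 N2) => M; set n := maxn N1 N2.
rewrite -lee_fin -sumEFin.
have := H1 n (leq_maxl _ _); have := H2 n (leq_maxr _ _).
rewrite /= sub0r normrN => h /fineK E.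
apply: le_trans (_ : ((fine (\sum_(n <= k <oo) g k))%:E <= _)%E); last first.
  by rewrite lee_fin (le_trans (ler_norm _)).
rewrite E; apply: le_trans (nneseries_lim_ge (n + M) (fun i _ _ => g0 i)).
by rewrite sum_shift.
Qed.

Lemma cos_psum_cvg (x : R) : sin (r%:R * x / 2) != 0 -> cos_cvg_at a x.
Proof.
move=> s0; apply: complex_cauchy_cvg => e e0.
have s0' : 0 < `|sin (r%:R * x / 2)| by rewrite normr_gt0.
have e20 : 0 < e / 2 by rewrite divr_gt0.
have [p Hp] := step_diff_tail_small (mulr_gt0 e20 s0').
have [N HN] := boundary_small p s0 e20.
exists p, (p + (N + r))%N => n pn.
have -> : n = (p + ((n - p - r) + r))%N.
  by rewrite subnK ?subnKC //; lia.
have NM : (N <= n - p - r)%N by lia.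
apply: (le_trans (cos_psumB_le _ _ _)); rewrite [leRHS]splitr.
apply: lerD; last exact: HN.
apply: (@le_trans _ _ ((\sum_(i < n - p - r) step_diff (p.+1 + i)) *
    `|sin (r%:R * x / 2)|^-1)).
  rewrite mulr_suml; apply: ler_sum => i _; apply: ler_wpM2l.
    exact: step_diff_ge0.
  exact: step_kernel_le_inv_sin.
by rewrite ler_pdivrMr // Hp.
Qed.

(** In the summation by parts of [S_N - S_n] each term is controlled by the
    majorant; the boundary terms disappear as [N] tends to infinity. *)
Lemma cos_psum_sum_le (n : nat) (x : R) : `|x| <= pi -> sin (r%:R * x / 2) != 0 ->
  ((normc (cos_psum a n x - cos_sum a x))%:E <=
   \sum_(i <oo) (step_diff (n.+1 + i) * kernel_majorant r (n.+1 + i) x)%:E)%E.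
Proof.
move=> xpi s0; apply/lee_addgt0Pr => e e0.
have e20 : 0 < e / 2 by rewrite divr_gt0.
have [N1 H1] := (complex_cvgP _ _).1 (cos_psum_cvg s0) _ e20.
have [N2 H2] := boundary_small n s0 e20.
set M := maxn N1 N2.
have h1 : (N1 <= n + (M + r))%N by rewrite /M; lia.
have h2 : (N2 <= M)%N by rewrite leq_maxr.
apply: (@le_trans _ _ ((\sum_(i < M)
    step_diff (n.+1 + i) * kernel_majorant r (n.+1 + i) x) + e)%:E).
  rewrite lee_fin.
  have -> : cos_psum a n x - cos_sum a x =
      (cos_psum a n x - cos_psum a (n + (M + r)) x) +
      (cos_psum a (n + (M + r)) x - cos_sum a x) by rewrite subrKA.
  apply: (le_trans (ler_normcD _ _)).
  rewrite normcB [e in leRHS]splitr addrA; apply: lerD; last exact: H1.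
  apply: (le_trans (cos_psumB_le _ _ _)); apply: lerD; last exact: H2.
  apply: ler_sum => i _; apply: ler_wpM2l; first exact: step_diff_ge0.
  apply: le_kernel_majorant => //; last exact: step_kernel_sin_le.
  by apply: (le_trans (norm_step_kernel_le _ _ _ _)); rewrite ler_nat addSn ltnS leq_addl.
rewrite EFinD leeD2r //.
apply: le_trans (nneseries_lim_ge M _).
  by rewrite big_mkord sumEFin.
by move=> i _ _; rewrite lee_fin mulr_ge0 ?kernel_majorant_ge0 // step_diff_ge0.
Qed.

End CosineSeries.

(** * Summability with harmonic weights *)

Section HarmonicWeights.
Variable R : realType.

Lemma sum_triangle (f u : nat -> R) (N : nat) :
  \sum_(k < N) f k * (\sum_(j < k.+1) u j) =
  \sum_(j < N) u j * (\sum_(j <= k < N) f k).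
Proof.
elim: N => [|N IH]; first by rewrite !big_ord0.
rewrite !big_ord_recr /= IH big_nat1 mulrDr addrA mulr_sumr; congr (_ + _);
  last exact: mulrC.
rewrite -big_split /=; apply: eq_bigr => j _.
by rewrite big_nat_recr 1?ltnW //= mulrDr (mulrC (f N)).
Qed.

Variables (r : nat) (beta : nat -> R) (a : nat -> R[i]).
Hypothesis beta_ge0 : forall n, (1 <= n)%N -> 0 <= beta n.
Hypothesis a_RBVS : RBVS beta r a.
Hypothesis beta_summable : (\sum_(1 <= k <oo) (beta k / k%:R)%:E < +oo)%E.

Lemma RBVS_step_diff_summable : (\sum_(1 <= k <oo) (step_diff r a k)%:E < +oo)%E.
Proof.
by have [C H] := a_RBVS; apply: le_lt_trans (H 1%N isT) _; rewrite ltry.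
Qed.

(** After [sum_triangle] the inner sums are partial sums of the tails that the
    class [RBVS] bounds by [C * beta j]. *)
Lemma RBVS_weighted_summable (A : R) : 0 <= A ->
  (\sum_(i <oo) (step_diff r a i.+1 * (\sum_(j < i.+1) A / j.+1%:R))%:E < +oo)%E.
Proof.
move=> A0; have [C H] := a_RBVS.
have t0 i : (0 <= (step_diff r a i.+1 * (\sum_(j < i.+1) A / j.+1%:R))%:E)%E.
  by rewrite lee_fin mulr_ge0 ?step_diff_ge0 // sumr_ge0 // => j _; rewrite divr_ge0.
pose q k := (beta k.+1 / k.+1%:R)%:E.
have b0 k : (0 <= q k)%E.
  by rewrite lee_fin divr_ge0 // beta_ge0.
pose S := (\sum_(0 <= k <oo) q k)%E.
have Sfin : S \is a fin_num.
  rewrite ge0_fin_numE ?nneseries_ge0 //; apply: le_lt_trans beta_summable.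
  rewrite /S le_eqVlt; apply/orP; left; apply/eqP.
  (* The added term of index 0 is beta 0 / 0 = 0. *)
  rewrite -(nneseries_addn (f := fun k => (beta k / k%:R)%:E) 1).
    by apply: eq_eseriesr => i _; rewrite addn1.
  by case=> [|k]; [rewrite invr0 mulr0 | exact: b0].
apply: (@le_lt_trans _ _ (A * `|C| * fine S)%:E); last by rewrite ltry.
apply: lime_le; first exact: is_cvg_nneseries.
apply: nearW => N; rewrite big_mkord sumEFin lee_fin.
rewrite (sum_triangle (fun i => step_diff r a i.+1) (fun j => A / j.+1%:R)).
apply: (@le_trans _ _ (\sum_(j < N) A * `|C| * (beta j.+1 / j.+1%:R))); last first.
  rewrite -mulr_sumr ler_wpM2l ?mulr_ge0 // -lee_fin fineK // -sumEFin.
  by have := @nneseries_lim_ge R _ xpredT 0%N N (fun i _ _ => b0 i); rewrite big_mkord.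
apply: ler_sum => j _.
apply: (@le_trans _ _ (A / j.+1%:R * (C * beta j.+1))); last first.
  rewrite -!mulrA ler_wpM2l // mulrCA [_^-1 * _]mulrC.
  by rewrite ler_wpM2r ?ler_norm // divr_ge0 ?beta_ge0.
apply: ler_wpM2l; first by rewrite divr_ge0.
rewrite -lee_fin; apply: le_trans (H j.+1 isT); rewrite -sumEFin.
have d0 i : (0 <= (step_diff r a i)%:E)%E by rewrite lee_fin step_diff_ge0.
apply: le_trans (nneseries_lim_ge N.+1 (fun i _ _ => d0 i)).
by rewrite big_add1.
Qed.

End HarmonicWeights.

(** * Convergence in mean *)

(** The integral of [f] is a supremum over simple functions below [f], and
    these are measurable even when [f] is not; so the bound applies to the
    modulus of the remainder, where [cos_sum] is a limit that is arbitrary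
    wherever the series diverges. *)
Lemma ge0_le_integral_ae_dominated (d : measure_display) (T : measurableType d)
    (R : realType) (mu : {measure set T -> \bar R}) (D : set T)
    (f g : T -> \bar R) :
  measurable D -> (forall x, D x -> 0 <= f x)%E ->
  (forall x, D x -> 0 <= g x)%E -> measurable_fun D g ->
  {ae mu, forall x, D x -> (f x <= g x)%E} ->
  (\int[mu]_(x in D) f x <= \int[mu]_(x in D) g x)%E.
Proof.
move=> mD f0 g0 mg fg.
rewrite ge0_integralE //; apply: ge_ereal_sup => _ /= [h hf <-].
rewrite -integralT_nnsfun (integral_mkcond D).
apply: ae_ge0_le_integral => //.
- by move=> x _; rewrite lee_fin; exact: fun_ge0.
- by apply/measurable_EFinP.
- by move=> x _; apply: erestrict_ge0.
- exact/(measurable_restrictT _ _).1.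
apply: filterS fg => x fgx _; apply: (le_trans (hf x)).
by rewrite /patch; case: ifPn => // /set_mem /fgx.
Qed.

Lemma negligible_sin_zeros (R : realType) (r : nat) : (0 < r)%N ->
  {ae lebesgue_measure, forall x : R, sin (r%:R * x / 2) != 0}.
Proof.
move=> r0; have r0' : (r%:R : R) != 0 by rewrite pnatr_eq0 -lt0n.
pose Z := range (fun l : int => 2 * (l%:~R * pi) / r%:R : R).
have cZ : countable Z by apply: card_le_trans (card_image_le _ _) (countableP _).
exists Z; split; last 1 first.
- move=> x /= /negP/negPn/eqP sx0; have [l []] := near_pi_multiple (r%:R * x / 2).
  rewrite sx0 normr0 mulr0 normr_le0 subr_eq0 => _ /eqP E; exists l => //.
  by rewrite -E; field.
- exact: countable_measurable.
- exact: countable_lebesgue_measure0.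
Qed.

(** The pointwise bound by the majorant is integrated term by term. *)
Lemma L1norm_remainder_le (R : realType) (r : nat) (a : nat -> R[i]) (n : nat) :
  (0 < r)%N ->
  (fun k => a k : R[i]^o) @ \oo --> (0 : R[i]^o) ->
  (\sum_(1 <= k <oo) (step_diff r a k)%:E < +oo)%E ->
  (L1norm (fun x => (cos_psum a n x - cos_sum a x)%R) <=
   ((2 * pi)^-1)%R%:E * \sum_(n <= i <oo)
     (step_diff r a i.+1 * (\sum_(j < i.+1) windows_mass R r / j.+1%:R))%R%:E)%E.
Proof.
move=> r0 a0 diff_fin.
have aeF := @ae_filter_ringOfSetsType _ _ R lebesgue_measure.
have ae_sin := @negligible_sin_zeros R r r0.
have m0 : 0 <= windows_mass R r by rewrite mulr_ge0 // divr_ge0.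
apply: lee_wpmul2l; first by rewrite lee_fin invr_ge0 mulr_ge0 // pi_ge0.
pose F i (x : R) :=
  (step_diff r a (n.+1 + i) * kernel_majorant r (n.+1 + i) x)%:E.
have F0 i x : (0 <= F i x)%E.
  by rewrite lee_fin mulr_ge0 ?step_diff_ge0 ?kernel_majorant_ge0.
have mF i : measurable_fun `[- (pi : R), pi] (F i).
  apply/measurable_EFinP; apply: measurable_funM => //.
  exact: measurable_kernel_majorant.
apply: (@le_trans _ _
  (\int[lebesgue_measure]_(x in `[(- pi)%R, pi%R]) \sum_(i <oo) F i x)%E).
  apply: ge0_le_integral_ae_dominated => //.
  - by move=> x _; rewrite lee_fin normc_ge0.
  - by move=> x _; apply: nneseries_ge0.
  - exact: (@ge0_emeasurable_sum _ _ _ _ F xpredT).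
  apply: filterS ae_sin => x sx; rewrite /= in_itv /= => /andP[x1 x2].
  by apply: cos_psum_sum_le => //; rewrite ler_norml x1.
rewrite integral_nneseries // -[leRHS]nneseries_addn; last first.
  move=> i; rewrite lee_fin mulr_ge0 ?step_diff_ge0 // sumr_ge0 // => j _.
  by rewrite divr_ge0.
apply: lee_nneseries => [i _ _|i _]; first exact: integral_ge0.
rewrite /F (_ : n.+1 + i = (i + n).+1)%N; last by rewrite addSn addnC.
under eq_integral do rewrite EFinM.
rewrite ge0_integralZl_EFin //; last 3 first.
- by move=> x _; rewrite lee_fin kernel_majorant_ge0.
- by apply/measurable_EFinP; exact: measurable_kernel_majorant.
- exact: step_diff_ge0.
rewrite EFinM; apply: lee_wpmul2l; first by rewrite lee_fin step_diff_ge0.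
exact: integral_kernel_majorant_le.
Qed.

Unset Implicit Arguments.

Theorem theorem4 (R : realType) (r : nat) (hr : (3 <= r)%N)
    (beta : nat -> R) (hbeta : forall n : nat, (1 <= n)%N -> 0 <= beta n)
    (a : nat -> R[i]) (ha : RBVS beta r a)
    (hnull : (fun n => a n : R[i]^o) @ \oo --> (0 : R[i]^o))
    (hsum : (\sum_(1 <= k <oo) (beta k / k%:R)%:E < +oo)%E) :
  {ae lebesgue_measure, forall x : R, cos_cvg_at a x} /\
  ((fun n => L1norm (fun x => cos_psum a n x - cos_sum a x)) @ \oo --> 0%E).
Proof.
have r0 : (0 < r)%N by exact: leq_trans hr.
have diff_fin := RBVS_step_diff_summable ha.
split.
  have aeF := @ae_filter_ringOfSetsType _ _ R lebesgue_measure.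
  apply: filterS (@negligible_sin_zeros R r r0) => x; exact: cos_psum_cvg.
have m0 : 0 <= windows_mass R r by rewrite mulr_ge0 // divr_ge0.
pose G i : \bar R :=
  (step_diff r a i.+1 * (\sum_(j < i.+1) windows_mass R r / j.+1%:R))%:E.
have G0 i : (0 <= G i)%E.
  rewrite lee_fin mulr_ge0 ?step_diff_ge0 // sumr_ge0 // => j _.
  by rewrite divr_ge0.
have Gfin : (\sum_(i <oo) G i < +oo)%E.
  exact: (RBVS_weighted_summable hbeta).
apply: (@squeeze_cvge _ _ _ _ (fun=> 0%E) _
  (fun n => (((2 * pi)^-1)%:E * \sum_(n <= i <oo) G i)%E)).
- apply: nearW => n; apply/andP; split; last exact: L1norm_remainder_le.
  rewrite mule_ge0 ?lee_fin ?invr_ge0 ?mulr_ge0 ?pi_ge0 // integral_ge0 // => x _.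
  by rewrite lee_fin normc_ge0.
- exact: cvg_cst.
rewrite -[X in _ --> X](mule0 ((2 * pi)^-1)%:E).
by apply: cvgeZl => //; apply: nneseries_tail_cvg.
Qed.
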